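(* Let $G$ be a finite solvable group whose character degree graph $\Delta(G)$ has diameter $3$, and suppose its vertex set admits a partition into nonempty sets \[ \rho(G)=\rho_1\sqcup\rho_2\sqcup\rho_3\sqcup\rho_4 \] such that every $\rho_i$ induces a complete subgraph, every vertex of $\rho_i$ is adjacent to every vertex of $\rho_{i+1}$ for $1\le i\le 3$, and there are no edges between nonconsecutive parts. Put $r_i=|\rho_i|$ for $1\le i\le 4$, let \[ \widehat C= \begin{pmatrix} r_4-1 & \sqrt{r_4r_3} & 0 & 0\\ \sqrt{r_4r_3} & r_3-1 & \sqrt{r_3r_2} & 0\\ 0 & \sqrt{r_3r_2} & r_2-1 & \sqrt{r_2r_1}\\ 0 & 0 & \sqrt{r_2r_1} & r_1-1 \end{pmatrix}, \] and let \[ p(\lambda)=\det(\lambda I_4-\widehat C)=\lambda^4+c_3\lambda^3+c_2\lambda^2+c_1\lambda+c_0, \] where \[ c_3=4-r_1-r_2-r_3-r_4, \] \[ c_2=r_1r_3+r_1r_4+r_2r_4-3r_1-3r_2-3r_3-3r_4+6, \] \[ c_1=2r_1r_3+2r_1r_4+2r_2r_4+r_1r_2r_3+r_2r_3r_4-3r_1-3r_2-3r_3-3r_4+4, \] \[ c_0=r_1r_3+r_1r_4+r_2r_4+r_1r_2r_3+r_2r_3r_4-r_1r_2r_3r_4-r_1-r_2-r_3-r_4+1. \] Then $p(\lambda)$ is irreducible over $\mathbb{Q}$ if and only if both of the following conditions hold: (i) $c_0\ne 0$, and $p(e)\neq 0$ for every $e\in\mathbb{Z}$ such that $e\mid c_0$;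 (ii) there do not exist integers $a,b,c,d$ satisfying \[ a+c=c_3,\qquad ac+b+d=c_2,\qquad ad+bc=c_1,\qquad bd=c_0; \] equivalently, $p(\lambda)$ cannot be expressed as $p(\lambda)=(\lambda^2+a\lambda+b)(\lambda^2+c\lambda+d)$ with $a,b,c,d\in\mathbb{Z}$. In particular, if $r_1=r_2=1$, then \[ c_3=2-r_3-r_4,\quad c_2=-2r_3-r_4,\quad c_1=r_3r_4+r_4-2,\quad c_0=r_3+r_4-1, \] and hence \[ p(\lambda)=\lambda^4+(2-r_3-r_4)\lambda^3-(2r_3+r_4)\lambda^2+(r_3r_4+r_4-2)\lambda+(r_3+r_4-1); \] in this special case, condition (ii) is equivalent to the nonexistence of integers $\alpha,\beta,\gamma,\delta$ satisfying \[ \alpha+\gamma=2-r_3-r_4,\quad \alpha\gamma+\beta+\delta=-2r_3-r_4,\quad \alpha\delta+\beta\gamma=r_3r_4+r_4-2,\quad \beta\delta=r_3+r_4-1. \] Moreover, \[ p(-1)=-r_1r_2r_3r_4<0, \] so $-1$ is never a root of $p(\lambda)$. If $r_1=2$, then \[ p(1)=4r_2(r_3+r_4-2); \] in particular, if $r_1=2$, $r_2\ge 1$, $r_3\ge 3$ and $r_4\ge 1$, then $p(1)>0$, so $1$ is not a root of $p(\lambda)$.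
   Context: For a finite group $G$, let $\mathrm{Irr}(G)$ be the set of irreducible complex characters of $G$, $\mathrm{cd}(G)=\{\chi(1)\mid\chi\in\mathrm{Irr}(G)\}$, and let $\rho(G)$ be the set of all primes dividing some element of $\mathrm{cd}(G)$. The character degree graph $\Delta(G)$ is the simple undirected graph with vertex set $\rho(G)$ in which two distinct primes $p,q$ are adjacent if and only if $pq$ divides $\chi(1)$ for some $\chi\in\mathrm{Irr}(G)$. Parts $\rho_i,\rho_j$ are nonconsecutive if $|i-j|\ge 2$. *)

(* Defs.v *)
From HB Require Import structures.
From mathcomp Require Import all_boot all_order all_algebra all_fingroup.
From mathcomp Require Import all_solvable all_field all_character.
From mathcomp Require Import finmap.

Set Implicit Arguments.
Unset Strict Implicit.
Unset Printing Implicit Defensive.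

Import Order.TTheory GRing.Theory Num.Theory.

Local Open Scope ring_scope.

Section DegreeGraph.

Variables (gT : finGroupType) (G : {group gT}).

(* The irreducible characters 'chi_i take values in algC, and the degree      *)
(* 'chi_i 1 is a positive natural number there; truncn recovers it in nat.    *)
Definition cd : {fset nat} :=
  [fset Num.truncn ('chi[G]_i 1%g) | i : Iirr G]%fset.

Definition rho : {fset nat} :=
  (\bigcup_(d <- cd) [fset p in primes d])%fset.

Definition degree_graph : rel rho :=
  fun p q => (p != q) && [exists d : cd, (val p * val q %| val d)%N].

End DegreeGraph.

Arguments degree_graph {gT} G.

Section Diameter.

Variables (V : finType) (e : rel V).

Definition walk (n : nat) (x y : V) : bool :=
  [exists w : n.-tuple V, path e x w && (last x w == y)].

(* A shortest walk visits no vertex twice, so its length is below #|V|. The   *)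
(* value #|V| is returned when y is not reachable from x.                     *)
Definition gdist (x y : V) : nat :=
  find (fun n => walk n x y) (iota 0 #|V|).

(* None stands for the infinite diameter of a disconnected graph. *)
Definition diameter : option nat :=
  if [forall x, forall y, connect e x y]
  then Some (\max_(x : V) \max_(y : V) gdist x y)%N
  else None.

End Diameter.

Definition Chat (R : rcfType) (r1 r2 r3 r4 : nat) : 'M[R]_4 :=
  let s (m n : nat) : R := Num.sqrt (m%:R * n%:R) in
  \matrix_(i < 4, j < 4)
    (nth [::]
      [:: [:: r4%:R - 1; s r4 r3;    0;          0         ];
          [:: s r4 r3;   r3%:R - 1;  s r3 r2;    0         ];
          [:: 0;         s r3 r2;    r2%:R - 1;  s r2 r1   ];
          [:: 0;         0;          s r2 r1;    r1%:R - 1 ]] i)`_j.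

Section Coefficients.

Variables r1 r2 r3 r4 : int.

Definition quartic_coef3 : int := 4 - r1 - r2 - r3 - r4.

Definition quartic_coef2 : int :=
  r1 * r3 + r1 * r4 + r2 * r4 - 3 * r1 - 3 * r2 - 3 * r3 - 3 * r4 + 6.

Definition quartic_coef1 : int :=
  2 * r1 * r3 + 2 * r1 * r4 + 2 * r2 * r4 + r1 * r2 * r3 + r2 * r3 * r4
  - 3 * r1 - 3 * r2 - 3 * r3 - 3 * r4 + 4.

Definition quartic_coef0 : int :=
  r1 * r3 + r1 * r4 + r2 * r4 + r1 * r2 * r3 + r2 * r3 * r4
  - r1 * r2 * r3 * r4 - r1 - r2 - r3 - r4 + 1.

Definition quartic : {poly int} :=
  'X^4 + quartic_coef3 *: 'X^3 + quartic_coef2 *: 'X^2 + quartic_coef1 *: 'X + quartic_coef0%:P.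

End Coefficients.

(* Main.v *)
Require Import Defs.
From HB Require Import structures.
From mathcomp Require Import all_boot all_order all_algebra all_fingroup.
From mathcomp Require Import all_solvable all_field all_character.
From mathcomp Require Import finmap ring zify.

Set Implicit Arguments.
Unset Strict Implicit.
Unset Printing Implicit Defensive.

Import Order.TTheory GRing.Theory Num.Theory.

Local Open Scope ring_scope.

(* Gauss's lemma reduces irreducibility over Q of a monic integer polynomial to the
   absence of factorizations into monic integer polynomials of smaller degree. For
   a quartic, such a factorization has degrees 1 + 3 or 2 + 2; the first one gives
   an integer root dividing the constant term. *)

(** * The characteristic polynomial of [Chat] *)

Lemma det_tridiag4 (K : comNzRingType) (a b c d x y z : K) :
  \det (\matrix_(i < 4, j < 4)
    (nth [::] [:: [:: a; x; 0; 0];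
                  [:: x; b; y; 0];
                  [:: 0; y; c; z];
                  [:: 0; 0; z; d]] i)`_j)
  = a * b * c * d - a * b * z ^+ 2 - a * y ^+ 2 * d - x ^+ 2 * c * d
    + x ^+ 2 * z ^+ 2.
Proof.
have det_row0 n (A : 'M[K]_n.+1) : \det A =
    \sum_j A ord0 j * ((-1) ^+ j * \det (row' ord0 (col' j A))).
  by rewrite (expand_det_row _ ord0).
(* Four rounds of expansion along the first row lead down to empty determinants, equal to 1; zero
   entries are pruned in each round. *)
do 4![rewrite !det_row0 !big_ord_recl !big_ord0 !mxE /= ?mul0r ?add0r].
rewrite !det_mx00.
ring.
Qed.

(** In a symmetric tridiagonal determinant the off-diagonal entries occur only squared, so the
    square roots disappear and the coefficients are integers. *)
Lemma char_poly_Chat (R : rcfType) (r1 r2 r3 r4 : nat) :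
  char_poly (Chat R r1 r2 r3 r4) = map_poly intr (quartic r1 r2 r3 r4).
Proof.
pose s (m n : nat) : R := Num.sqrt (m%:R * n%:R).
have sE m n : (s m n)%:P ^+ 2 = m%:R * n%:R :> {poly R}.
  by rewrite -rmorphXn sqr_sqrtr ?mulr_ge0 ?ler0n // rmorphM /= !rmorph_nat.
have -> : char_poly (Chat R r1 r2 r3 r4) = \det (\matrix_(i < 4, j < 4)
    (nth [::] [:: [:: 'X - (r4%:R - 1); - (s r4 r3)%:P; 0; 0];
                  [:: - (s r4 r3)%:P; 'X - (r3%:R - 1); - (s r3 r2)%:P; 0];
                  [:: 0; - (s r3 r2)%:P; 'X - (r2%:R - 1); - (s r2 r1)%:P];
                  [:: 0; 0; - (s r2 r1)%:P; 'X - (r1%:R - 1)]] i)`_j).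
  congr (\det _); apply/matrixP => i j; rewrite !mxE.
  case: i => [[|[|[|[|//]]]] hi]; case: j => [[|[|[|[|//]]]] hj];
    by rewrite -?/(s _ _) /= ?rmorphB ?rmorph_nat ?rmorph1 ?mulr0n ?mulr1n ?sub0r ?oppr0.
(* Arbitrary coefficients keep the four integers folded while scalings turn into products, the form
   that [ring] can treat. *)
have map_quarticE (c3 c2 c1 c0 : int) :
    map_poly intr ('X^4 + c3 *: 'X^3 + c2 *: 'X^2 + c1 *: 'X + c0%:P)
    = 'X^4 + c3%:~R * 'X^3 + c2%:~R * 'X^2 + c1%:~R * 'X + c0%:~R :> {poly R}.
  rewrite !rmorphD /= !map_polyZ !map_polyXn map_polyX map_polyC /=.
  by rewrite -!mul_polyC !rmorph_int.
rewrite det_tridiag4 !sqrrN !sE map_quarticE.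
rewrite /quartic_coef3 /quartic_coef2 /quartic_coef1 /quartic_coef0.
ring.
Qed.

(** * Gauss's lemma for monic integer polynomials *)

Lemma size_monic_gt0 (R : nzRingType) (u : {poly R}) :
  u \is monic -> (0 < size u)%N.
Proof. by move/monic_neq0; rewrite size_poly_gt0. Qed.

(** A monic integer factor also divides over the rationals, where irreducibility forces its size.
    Conversely, a rational divisor is a scalar multiple of an integer divisor, which can be made
    monic. *)
Lemma irreducible_rat_monic (p : {poly int}) : p \is monic -> (1 < size p)%N ->
  irreducible_poly (map_poly intr p : {poly rat}) <->
  (forall u v : {poly int}, u \is monic -> v \is monic -> p = u * v ->
     size u = 1%N \/ size v = 1%N).
Proof.
move=> p_mon p_gt1; split=> [[_ p_irr] u v u_mon v_mon pE | p_irr].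
  have [-> | u_neq1] := eqVneq (size u) 1%N; [by left | right].
  have /eqp_size : map_poly (intr : int -> rat) u %= map_poly intr p.
    by apply: p_irr; rewrite ?size_rat_int_poly // dvdp_rat_int pE dvdp_mulIl.
  rewrite !size_rat_int_poly pE size_monicM ?monic_neq0 //.
  move: (size_monic_gt0 u_mon) (size_monic_gt0 v_mon).
  by move: (size u) (size v); lia.
split=> [|q q_neq1 q_dvd]; first by rewrite size_rat_int_poly.
have [u [a a_neq0 qE] [v pE]] := dvdpP_rat_int q_dvd.
(* The leading coefficients are mutually inverse integers; scaling each factor by that of the other
   makes both monic and preserves the product. *)
have uv1 : lead_coef v * lead_coef u = 1.
  by rewrite mulrC -lead_coefM -pE; apply/monicP.
have u_mon : lead_coef v *: u \is monic by rewrite monicE lead_coefZ uv1.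
have v_mon : lead_coef u *: v \is monic by rewrite monicE lead_coefZ mulrC uv1.
have pE' : p = (lead_coef v *: u) * (lead_coef u *: v).
  by rewrite -scalerAl -scalerAr scalerA uv1 scale1r.
have lu_neq0 : lead_coef u != 0.
  by apply: contra_eq_neq uv1 => ->; rewrite mulr0.
have lv_neq0 : lead_coef v != 0.
  by apply: contra_eq_neq uv1 => ->; rewrite mul0r.
have q_size : size q = size u by rewrite qE size_scale // size_rat_int_poly.
(* A divisor of [p] is associated with [p] as soon as the sizes agree. *)
rewrite -dvdp_size_eqp // q_size size_rat_int_poly.
have [] := p_irr _ _ u_mon v_mon pE'; rewrite size_scale //.
  by move=> u_size; rewrite q_size u_size eqxx in q_neq1.
move=> v_size; rewrite pE size_mul -?lead_coef_eq0 // v_size addn1 //.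
Qed.

(** * Monic polynomials of degrees one, two and four *)

Section MonicSmallDegree.

Variable R : comNzRingType.
Implicit Types (a b c d : R) (u : {poly R}).

Lemma monic_size2E u : u \is monic -> size u = 2%N -> u = 'X - (- u`_0)%:P.
Proof.
move=> /monicP u_mon u_size; apply/polyP => i; rewrite polyCN opprK !coefE.
rewrite lead_coefE u_size /= in u_mon.
case: i => [|[|i]] /=; rewrite ?add0r ?addr0 //.
by rewrite nth_default ?u_size.
Qed.

Lemma monic_size3E u : u \is monic -> size u = 3%N ->
  u = 'X^2 + u`_1 *: 'X + (u`_0)%:P.
Proof.
move=> /monicP u_mon u_size; apply/polyP => i; rewrite !coefE.
rewrite lead_coefE u_size /= in u_mon.
case: i => [|[|[|i]]] /=; rewrite ?mulr0 ?mulr1 ?add0r ?addr0 //.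
by rewrite nth_default ?u_size.
Qed.

Lemma monic_quadratic a b :
  let p := 'X^2 + a *: 'X + b%:P in p \is monic /\ size p = 3%N.
Proof.
have le2 : (size (a *: 'X + b%:P)%R < size ('X^2 : {poly R}))%N.
  rewrite size_polyXn ltnS; apply/leq_sizeP => -[|[|i]] // _.
  by rewrite !coefE mulr0 addr0.
by rewrite /= -addrA monicE lead_coefDl // lead_coefXn size_polyDl // size_polyXn.
Qed.

Lemma monic_quartic c3 c2 c1 c0 :
  let p := 'X^4 + c3 *: 'X^3 + c2 *: 'X^2 + c1 *: 'X + c0%:P in
  p \is monic /\ size p = 5%N.
Proof.
have le4 : (size (c3 *: 'X^3 + c2 *: 'X^2 + c1 *: 'X + c0%:P)%R
    < size ('X^4 : {poly R}))%N.
  rewrite size_polyXn ltnS; apply/leq_sizeP => -[|[|[|[|i]]]] // _.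
  by rewrite !coefE /= !mulr0 !addr0.
rewrite /= -!addrA; rewrite -!addrA in le4.
by rewrite monicE lead_coefDl // lead_coefXn size_polyDl // size_polyXn.
Qed.

Lemma quartic_eq_mul_quadratic c3 c2 c1 c0 a b c d :
  'X^4 + c3 *: 'X^3 + c2 *: 'X^2 + c1 *: 'X + c0%:P =
    ('X^2 + a *: 'X + b%:P) * ('X^2 + c *: 'X + d%:P) <->
  [/\ a + c = c3, a * c + b + d = c2, a * d + b * c = c1 & b * d = c0].
Proof.
have -> : ('X^2 + a *: 'X + b%:P) * ('X^2 + c *: 'X + d%:P) =
    'X^4 + (a + c) *: 'X^3 + (a * c + b + d) *: 'X^2 + (a * d + b * c) *: 'X
    + (b * d)%:P.
  by rewrite -!mul_polyC !(rmorphD, rmorphM) /=; ring.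
split=> [E | [-> -> -> ->] //].
(* Both sides are monic of degree 4, so only the coefficients of degrees 0 to 3 carry
   information. *)
have coefs i := congr1 (fun p : {poly R} => p`_i) E.
have := (coefs 0%N, coefs 1%N, coefs 2%N, coefs 3%N).
rewrite !coefE /= !(mulr0, mulr1, addr0, add0r).
by case=> [[[-> ->] ->] ->].
Qed.

End MonicSmallDegree.

Lemma irreducible_rat_monic_quartic (c3 c2 c1 c0 : int) :
  let p := 'X^4 + c3 *: 'X^3 + c2 *: 'X^2 + c1 *: 'X + c0%:P in
  irreducible_poly (map_poly intr p : {poly rat}) <->
  (forall e : int, (e %| c0)%Z -> p.[e] <> 0) /\
  ~ (exists a b c d : int,
       p = ('X^2 + a *: 'X + b%:P) * ('X^2 + c *: 'X + d%:P)).
Proof.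
move=> p; have [p_mon p_size] : p \is monic /\ size p = 5%N.
  exact: monic_quartic.
have p0 : p`_0 = c0 by rewrite !coefE /= !mulr0 !add0r.
have p_gt1 : (1 < size p)%N by rewrite p_size.
split=> [/(irreducible_rat_monic p_mon p_gt1) p_irr | [p_root p_quad]].
  (* A root splits off a linear factor and leaves a cubic; neither this splitting nor one into two
     quadratics has a constant factor. *)
  split=> [e _ /eqP/factor_theorem[q pE] | [a [b [c [d pE]]]]].
    have q_mon : q \is monic by rewrite -(monicMr _ (monicXsubC e)) -pE.
    have [] := p_irr _ _ q_mon (monicXsubC e) pE; rewrite ?size_XsubC // => q1.
    by move: p_size; rewrite pE size_monicM ?polyXsubC_eq0 // q1 size_XsubC.
  have [[mon1 size1] [mon2 size2]] := (monic_quadratic a b, monic_quadratic c d).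
  by have [] := p_irr _ _ mon1 mon2 pE; rewrite ?size1 ?size2.
apply/(irreducible_rat_monic p_mon p_gt1) => u v u_mon v_mon pE.
have no_linear w z : w \is monic -> p = w * z -> size w <> 2%N.
  move=> w_mon pwz w_size; apply: (p_root (- w`_0)).
    by rewrite -p0 pwz coef0M dvdzE abszN -dvdzE dvdz_mulr.
  by rewrite pwz hornerM [w in w.[_]]monic_size2E // hornerXsubC subrr mul0r.
have u_neq2 := no_linear _ _ u_mon pE.
have v_neq2 : size v <> 2%N by apply: (no_linear v u); rewrite // mulrC.
have uv_neq3 : ~ (size u = 3%N /\ size v = 3%N).
  case=> u3 v3; apply: p_quad; exists u`_1, u`_0, v`_1, v`_0.
  by rewrite -!monic_size3E.
(* The two sizes are positive with sum 6; without 2 + 4 and 3 + 3, only 1 + 5 remains. *)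
have := p_size; rewrite pE size_monicM ?monic_neq0 //.
move: (size_monic_gt0 u_mon) (size_monic_gt0 v_mon) u_neq2 v_neq2 uv_neq3.
by move: (size u) (size v); lia.
Qed.

(** * Values of the quartic and the final assembly *)

Lemma horner_quartic (r1 r2 r3 r4 x : int) :
  (quartic r1 r2 r3 r4).[x] = x ^+ 4 + quartic_coef3 r1 r2 r3 r4 * x ^+ 3
    + quartic_coef2 r1 r2 r3 r4 * x ^+ 2 + quartic_coef1 r1 r2 r3 r4 * x
    + quartic_coef0 r1 r2 r3 r4.
Proof. by rewrite /quartic !hornerE. Qed.

Theorem theorem6p1 (R : rcfType) (gT : finGroupType) (G : {group gT})
  (solG : solvable G)
  (diamG : diameter (degree_graph G) = Some 3%N)
  (P : nat -> {set rho G})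
  (P_neq0 : forall i, (1 <= i <= 4)%N -> P i != set0)
  (P_disj : forall i j, (1 <= i <= 4)%N -> (1 <= j <= 4)%N -> i != j ->
     [disjoint P i & P j])
  (P_cover : \bigcup_(1 <= i < 5) P i = [set: rho G])
  (P_complete : forall i, (1 <= i <= 4)%N ->
     {in P i &, forall x y, x != y -> degree_graph G x y})
  (P_consec : forall i, (1 <= i <= 3)%N ->
     {in P i & P i.+1, forall x y, degree_graph G x y})
  (P_nonconsec : forall i j, (1 <= i <= 4)%N -> (1 <= j <= 4)%N ->
     (i.+2 <= j)%N || (j.+2 <= i)%N ->
     {in P i & P j, forall x y, ~~ degree_graph G x y})
  (r1 r2 r3 r4 : nat)
  (r1E : r1 = #|P 1%N|) (r2E : r2 = #|P 2%N|)
  (r3E : r3 = #|P 3%N|) (r4E : r4 = #|P 4%N|) :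
  let c3 := quartic_coef3 r1 r2 r3 r4 in
  let c2 := quartic_coef2 r1 r2 r3 r4 in
  let c1 := quartic_coef1 r1 r2 r3 r4 in
  let c0 := quartic_coef0 r1 r2 r3 r4 in
  let p := quartic r1 r2 r3 r4 in
  let cond_i := c0 <> 0 /\ (forall e : int, (e %| c0)%Z -> p.[e] <> 0) in
  let cond_ii := ~ exists a b c d : int,
    [/\ a + c = c3, a * c + b + d = c2, a * d + b * c = c1 & b * d = c0] in
  [/\ char_poly (Chat R r1 r2 r3 r4) = map_poly intr p,
      irreducible_poly (map_poly intr p : {poly rat}) <-> cond_i /\ cond_ii,
      cond_ii <-> ~ (exists a b c d : int,
        p = ('X^2 + a *: 'X + b%:P) * ('X^2 + c *: 'X + d%:P)),
      r1 = 1%N -> r2 = 1%N ->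
        [/\ [/\ c3 = 2 - r3%:Z - r4%:Z, c2 = - 2 * r3%:Z - r4%:Z,
                c1 = r3%:Z * r4%:Z + r4%:Z - 2 & c0 = r3%:Z + r4%:Z - 1],
            p = 'X^4 + (2 - r3%:Z - r4%:Z) *: 'X^3
                - (2 * r3%:Z + r4%:Z) *: 'X^2
                + (r3%:Z * r4%:Z + r4%:Z - 2) *: 'X
                + (r3%:Z + r4%:Z - 1)%:P
          & cond_ii <-> ~ exists alpha beta gamma delta : int,
              [/\ alpha + gamma = 2 - r3%:Z - r4%:Z,
                  alpha * gamma + beta + delta = - 2 * r3%:Z - r4%:Z,
                  alpha * delta + beta * gamma = r3%:Z * r4%:Z + r4%:Z - 2
                & beta * delta = r3%:Z + r4%:Z - 1]]
    & [/\ p.[-1] = - (r1%:Z * r2%:Z * r3%:Z * r4%:Z),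
          - (r1%:Z * r2%:Z * r3%:Z * r4%:Z) < 0,
          ~~ root p (-1),
          r1 = 2%N -> p.[1] = 4 * r2%:Z * (r3%:Z + r4%:Z - 2)
        & r1 = 2%N -> (1 <= r2)%N -> (3 <= r3)%N -> (1 <= r4)%N ->
            0 < p.[1] /\ ~~ root p 1]].
Proof.
(* Nonempty parts make every [r_i] positive, which gives the strict sign of [p.[-1]]. *)
have r_gt0 i : (1 <= i <= 4)%N -> (0 < #|P i|)%N.
  by move=> /P_neq0; rewrite card_gt0.
have r1_gt0 : (0 < r1)%N by rewrite r1E r_gt0.
have r2_gt0 : (0 < r2)%N by rewrite r2E r_gt0.
have r3_gt0 : (0 < r3)%N by rewrite r3E r_gt0.
have r4_gt0 : (0 < r4)%N by rewrite r4E r_gt0.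
clear - r1_gt0 r2_gt0 r3_gt0 r4_gt0.
move=> c3 c2 c1 c0 p cond_i cond_ii.
have cond_iiE : cond_ii <-> ~ (exists a b c d : int,
    p = ('X^2 + a *: 'X + b%:P) * ('X^2 + c *: 'X + d%:P)).
  by split=> no_factors [a [b [c [d E]]]]; apply: no_factors;
    exists a, b, c, d; apply/quartic_eq_mul_quadratic.
have pN1 : p.[-1] = - (r1%:Z * r2%:Z * r3%:Z * r4%:Z).
  rewrite horner_quartic /quartic_coef3 /quartic_coef2 /quartic_coef1.
  rewrite /quartic_coef0; ring.
have prod_lt0 : - (r1%:Z * r2%:Z * r3%:Z * r4%:Z) < 0.
  by rewrite oppr_lt0 !mulr_gt0.
have p1 : r1 = 2%N -> p.[1] = 4 * r2%:Z * (r3%:Z + r4%:Z - 2).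
  move=> r1_eq2; rewrite horner_quartic /quartic_coef3 /quartic_coef2.
  rewrite /quartic_coef1 /quartic_coef0 r1_eq2; ring.
split=> //; first exact: char_poly_Chat.
- rewrite cond_iiE /cond_i.
  have := irreducible_rat_monic_quartic c3 c2 c1 c0; rewrite /= -/p => ->.
  split=> [[no_root no_quad] | [[_ no_root] no_quad]] //; split=> //; split=> //.
  (* If [c0] vanished, then 0 would divide [c0] and be a root, since [p.[0] = c0]. *)
  move=> c0_eq0; apply: (no_root 0); first by rewrite c0_eq0.
  by rewrite horner_quartic !expr0n /= !mulr0 !addr0 add0r.
- move=> r1_eq1 r2_eq1.
  have c3E : c3 = 2 - r3%:Z - r4%:Z.
    by rewrite /c3 /quartic_coef3 r1_eq1 r2_eq1; ring.
  have c2E : c2 = - 2 * r3%:Z - r4%:Z.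
    by rewrite /c2 /quartic_coef2 r1_eq1 r2_eq1; ring.
  have c1E : c1 = r3%:Z * r4%:Z + r4%:Z - 2.
    by rewrite /c1 /quartic_coef1 r1_eq1 r2_eq1; ring.
  have c0E : c0 = r3%:Z + r4%:Z - 1.
    by rewrite /c0 /quartic_coef0 r1_eq1 r2_eq1; ring.
  split=> //; last by rewrite /cond_ii c3E c2E c1E c0E.
  rewrite /p /quartic -/c3 -/c2 -/c1 -/c0 c3E c2E c1E c0E.
  (* The subtracted quadratic term becomes a scaling by the opposite, so that only the coefficients
     of ['X^2] have to be compared. *)
  by rewrite -scaleNr; congr (_ + _ *: _ + _ + _); ring.
- split=> //; first by rewrite rootE pN1 lt_eqF.
  move=> r1_eq2 _ r3_ge3 _.
  have p1_gt0 : 0 < p.[1] by rewrite p1 // !mulr_gt0 //; lia.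
  by rewrite rootE gt_eqF.
Qed.
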